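(* For every integer $d$, there exist integers $D$ and $\Gamma$ such that for any two (not necessarily finite) plane $c$-trees $T$ and $T'$, if for each $D$-Hintikka type the trees $T$ and $T'$ have the same number of nodes of this type or the number of nodes of this type is at least $\Gamma$ in both $T$ and $T'$, then the sets of $d$-sentences satisfied by $T$ and $T'$ are the same.
   Context: Plane $c$-trees: rooted trees (possibly infinite) in the signature consisting of binary relations $\mathbf{parnt}(x,y)$ ($x$ is a child of $y$), $\mathbf{succ}(x,y)$ ($x,y$ are consecutive children of the same node in the given linear order of children), and countably many constants $c_1,c_2,\dots$, some of which are interpreted by pairwise distinct nodes. A $d$-formula is a first order formula of quantifier depth at most $d$ using no constants other than $c_1,\dots,c_d$; a $d$-sentence is a $d$-formula without free variables. A first order formula is local if every quantifier is restricted to neighbors (via $\mathbf{parnt}$ or $\mathbf{succ}$) of some variable, i.e. has the form $\forall_z x$ or $\exists_z x$ with $x$ a neighbor of $z$. The $D$-Hintikka type of a node $v$ of $T$ is the set of local $D$-formulas with one free variable (up to equivalence) satisfied by $v$ in $T$. *)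

(* Defs.v *)
From mathcomp Require Import all_boot.
From mathcomp Require Import all_classical.

Set Implicit Arguments.
Unset Strict Implicit.
Unset Printing Implicit Defensive.

Local Open Scope classical_set_scope.

(* [parent_iter] says that every node is at finite distance from the root;    *)
(* with [parent_root] it makes the root the only node without a parent and    *)
(* excludes cycles. [sib_lt x y] holds only between children of the same      *)
(* node; there it is an arbitrary strict linear order.                        *)
Record plane_tree : Type := PlaneTree {
  node :> Type;
  troot : node;
  parent : node -> option node;
  parent_root : parent troot = None;
  parent_iter : forall x, exists n, iter n (obind parent) (Some x) = Some troot;
  sib_lt : node -> node -> Prop;
  sib_lt_sibling : forall x y, sib_lt x y ->
    exists p, parent x = Some p /\ parent y = Some p;
  sib_lt_irr : forall x, ~ sib_lt x x;
  sib_lt_trans : forall x y z, sib_lt x y -> sib_lt y z -> sib_lt x z;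
  sib_lt_total : forall p x y, parent x = Some p -> parent y = Some p ->
    x <> y -> sib_lt x y \/ sib_lt y x
}.

Definition parnt (T : plane_tree) (x y : T) : Prop := parent x = Some y.

Definition succ (T : plane_tree) (x y : T) : Prop :=
  sib_lt x y /\ ~ (exists z, sib_lt x z /\ sib_lt z y).

(* [const i] is the interpretation of the constant c_(i+1), [None] if that    *)
(* constant is not interpreted.                                               *)
Record plane_ctree : Type := PlaneCTree {
  ptree :> plane_tree;
  const : nat -> option ptree;
  const_inj : forall i j v, const i = Some v -> const j = Some v -> i = j
}.

Inductive term (n : nat) : Type :=
  | Var of 'I_n
  | Cst of nat.
Arguments Cst {n}.

(* First order formulas whose free variables are among the n variables 'I_n.  *)
(* Variables are de Bruijn indices: under a quantifier, [ord0] is the bound   *)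
(* variable and [lift ord0 i] is the outer variable i.                        *)
Inductive formula (n : nat) : Type :=
  | Bot
  | Equ of term n & term n
  | Par of term n & term n
  | Suc of term n & term n
  | And of formula n & formula n
  | Or of formula n & formula n
  | Imp of formula n & formula n
  | All of formula n.+1
  | Exi of formula n.+1.
Arguments Bot {n}.

Definition env_cons (V : Type) (n : nat) (v : V) (e : 'I_n -> V) :
    'I_n.+1 -> V :=
  fun i => if unlift ord0 i is Some j then e j else v.

Definition eval (T : plane_ctree) (n : nat) (e : 'I_n -> T) (t : term n) :
    option T :=
  match t with
  | Var i => Some (e i)
  | Cst i => const T i
  end.

(* An atomic formula mentioning an uninterpreted constant is false. *)
Definition holds2 (V : Type) (r : V -> V -> Prop) (a b : option V) : Prop :=
  match a, b with
  | Some x, Some y => r x y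
  | _, _ => False
  end.

Fixpoint sat (T : plane_ctree) (n : nat) (phi : formula n) (e : 'I_n -> T) :
    Prop :=
  match phi with
  | Bot => False
  | Equ t u => holds2 eq (eval e t) (eval e u)
  | Par t u => holds2 (@parnt T) (eval e t) (eval e u)
  | Suc t u => holds2 (@succ T) (eval e t) (eval e u)
  | And f g => sat f e /\ sat g e
  | Or f g => sat f e \/ sat g e
  | Imp f g => sat f e -> sat g e
  | All f => forall v : T, sat f (env_cons v e)
  | Exi f => exists v : T, sat f (env_cons v e)
  end.

Fixpoint qdepth (n : nat) (phi : formula n) : nat :=
  match phi with
  | Bot | Equ _ _ | Par _ _ | Suc _ _ => 0
  | And f g | Or f g | Imp f g => maxn (qdepth f) (qdepth g)
  | All f | Exi f => (qdepth f).+1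
  end.

Definition term_below (d n : nat) (t : term n) : bool :=
  if t is Cst i then i < d else true.

Fixpoint csts_below (d n : nat) (phi : formula n) : bool :=
  match phi with
  | Bot => true
  | Equ t u | Par t u | Suc t u => term_below d t && term_below d u
  | And f g | Or f g | Imp f g => csts_below d f && csts_below d g
  | All f | Exi f => csts_below d f
  end.

Definition d_formula (d n : nat) (phi : formula n) : bool :=
  (qdepth phi <= d) && csts_below d phi.

(* "The newly bound variable is a neighbor of the outer variable z." *)
Definition nbr (n : nat) (z : 'I_n) : formula n.+1 :=
  let x := Var (@ord0 n) in
  let z' := Var (lift ord0 z) in
  Or (Or (Par x z') (Par z' x)) (Or (Suc x z') (Suc z' x)).

Definition AllNbr (n : nat) (z : 'I_n) (phi : formula n.+1) : formula n :=
  All (Imp (nbr z) phi).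

Definition ExiNbr (n : nat) (z : 'I_n) (phi : formula n.+1) : formula n :=
  Exi (And (nbr z) phi).

Inductive local : forall n : nat, formula n -> Prop :=
  | local_Bot n : local (@Bot n)
  | local_Equ n (t u : term n) : local (Equ t u)
  | local_Par n (t u : term n) : local (Par t u)
  | local_Suc n (t u : term n) : local (Suc t u)
  | local_And n (f g : formula n) : local f -> local g -> local (And f g)
  | local_Or n (f g : formula n) : local f -> local g -> local (Or f g)
  | local_Imp n (f g : formula n) : local f -> local g -> local (Imp f g)
  | local_AllNbr n (z : 'I_n) (f : formula n.+1) :
      local f -> local (AllNbr z f)
  | local_ExiNbr n (z : 'I_n) (f : formula n.+1) :
      local f -> local (ExiNbr z f).

(* The set is closed under equivalence of local D-formulas, so equality of    *)
(* these sets is equality of types up to equivalence.                         *)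
Definition hintikka_type (D : nat) (T : plane_ctree) (v : T) :
    set (formula 1) :=
  [set phi | [/\ local phi, d_formula D phi & sat phi (fun _ : 'I_1 => v)]].

Definition nodes_of_type (D : nat) (T : plane_ctree) (tau : set (formula 1)) :
    set T :=
  [set v | hintikka_type D v = tau].
Arguments nodes_of_type D T tau : clear implicits.

Definition models (T : plane_ctree) (phi : formula 0) : Prop :=
  forall e : 'I_0 -> T, sat phi e.

Definition d_sentences (d : nat) (T : plane_ctree) : set (formula 0) :=
  [set phi | d_formula d phi /\ models T phi].

(* Main.v *)
Require Import Defs.
From mathcomp Require Import all_boot.
From mathcomp Require Import all_classical.

Set Implicit Arguments.
Unset Strict Implicit.
Unset Printing Implicit Defensive.

Local Open Scope classical_set_scope.
Local Open Scope card_scope.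

(* Duplicator wins the d-round Ehrenfeucht-Fraisse game by keeping the        *)
(* pebbled tuples equivalent for a local back-and-forth game, whose number of *)
(* rounds shrinks fast as the main game goes on. A move near the pebbles is   *)
(* answered in the local game; for a move a far from the pebbles it is enough *)
(* to find a node of the same local type far from the pebbles of the other    *)
(* tree. As degrees are unbounded, abundance of nodes of that type does not   *)
(* suffice: all of them may lie close to one pebble. One therefore counts the *)
(* nodes with the local type of the h-th ancestor of a: two nodes at distance *)
(* at most h share an ancestor at most h levels up, so the nodes close to the *)
(* pebbles have only boundedly many h-th ancestors altogether.                *)

(** The invariant of the main game is [locequiv]: a back-and-forth game whose moves go only to
    neighbors of chosen nodes. Positions far apart in both trees glue ([locequiv_union]), so a far
    move reduces to matching a single node up to local equivalence. That equivalence of single nodes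
    is equality of local types ([ltype_locequiv]), which is how the hypothesis on counts enters. The
    tree structure bounds what lies near a pebble: balls may be infinite, but the h-th ancestors of
    the nodes within distance h of a node are at most 2h + 1 ([near_anc_iter]). A match for an
    ancestor yields a match for the descendant ([locequiv_descendant]). [far_response] combines
    these, [depth] sums up the local rounds required, and [locequiv_depth_sat] plays the game along
    a formula. *)

Definition adj (T : plane_ctree) (x y : T) : Prop :=
  (parnt y x \/ parnt x y) \/ (succ y x \/ succ x y).

Lemma adj_sym (T : plane_ctree) (x y : T) : adj x y -> adj y x.
Proof. by rewrite /adj; tauto. Qed.

Fixpoint within_dist (T : plane_ctree) (r : nat) (x y : T) : Prop :=
  if r is r'.+1 then exists z, (x = z \/ adj x z) /\ within_dist r' z y
  else x = y.

Lemma near_refl (T : plane_ctree) r (x : T) : within_dist r x x.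
Proof. by elim: r => //= r IH; exists x; split; [left|]. Qed.

Lemma near_trans (T : plane_ctree) r s (x y z : T) :
  within_dist r x y -> within_dist s y z -> within_dist (r + s) x z.
Proof.
elim: r x => [|r IH] x /= => [->//|[w [xw wy]] yz].
by exists w; split=> //; apply: IH.
Qed.

Lemma near_le (T : plane_ctree) r s (x y : T) :
  r <= s -> within_dist r x y -> within_dist s x y.
Proof.
by move=> rs xy; rewrite -(subnKC rs); apply: near_trans xy (near_refl _ _).
Qed.

Lemma near_adj (T : plane_ctree) (x y : T) : adj x y -> within_dist 1 x y.
Proof. by move=> xy; exists y; split; [right|]. Qed.

Lemma near_sym (T : plane_ctree) r (x y : T) :
  within_dist r x y -> within_dist r y x.
Proof.
elim: r x => [|r IH] x /= => [->//|[z [xz /IH zy]]].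
case: xz => [xz|/adj_sym/near_adj xz]; last first.
  by have := near_trans zy xz; rewrite addn1.
by exists y; split; [left|rewrite xz].
Qed.

(* The root is its own ancestor. *)
Definition anc (T : plane_ctree) (x : T) : T := odflt x (parent x).

Lemma near_anc (T : plane_ctree) h (x : T) : within_dist h (iter h (@anc T) x) x.
Proof.
elim: h => //= h IH; exists (iter h (@anc T) x); split=> //.
rewrite /anc; case E: (parent _) => [z|] /=; [right|by left].
by left; left.
Qed.

Lemma adj_anc (T : plane_ctree) (x y : T) : adj x y ->
  exists i j, [/\ i <= 1, j <= 1 & iter i (@anc T) x = iter j (@anc T) y].
Proof.
have sib (a b : T) : succ a b -> anc a = anc b.
  by move=> [/sib_lt_sibling[p [pa pb]] _]; rewrite /anc pa pb.
have par (a b : T) : parnt a b -> anc a = b by rewrite /anc => ->.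
case=> [[/par|/par]|[/sib|/sib]] E.
- by exists 0, 1.
- by exists 1, 0.
- by exists 1, 1.
- by exists 1, 1.
Qed.

(** The ends of an edge meet after at most one step up ([adj_anc]); along a path the meeting points
    are pushed further up, since iterates of [anc] commute. *)
Lemma near_common_anc (T : plane_ctree) r (x y : T) : within_dist r x y ->
  exists i j, [/\ i <= r, j <= r & iter i (@anc T) x = iter j (@anc T) y].
Proof.
elim: r x => [|r IH] x /=; first by move=> ->; exists 0, 0.
move=> [z [xz /IH [i [j [ir jr E]]]]].
have [i0 [j0 [i1 j1 E0]]] : exists i j,
    [/\ i <= 1, j <= 1 & iter i (@anc T) x = iter j (@anc T) z].
  by case: xz => [->|/adj_anc//]; exists 0, 0.
exists (i + i0), (j0 + j); split.
- by rewrite -addn1 leq_add.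
- by rewrite -add1n leq_add.
- by rewrite iterD E0 -iterD addnC iterD E -iterD.
Qed.

Lemma near_anc_iter (T : plane_ctree) h (x y : T) : within_dist h x y ->
  exists j : 'I_(h + h).+1, iter h (@anc T) x = iter j (@anc T) y.
Proof.
move=> /near_common_anc [i [j [ih jh E]]].
(* Climb the remaining h - i levels above the common ancestor. *)
have jP : h - i + j < (h + h).+1 by rewrite ltnS leq_add // leq_subr.
by exists (Ordinal jP); rewrite /= iterD -E -iterD subnK.
Qed.

(** * The local back-and-forth game *)

(* The constants below [d] count as permanently pebbled. *)
Definition vals (d : nat) (T T' : plane_ctree) (S : set (T * T')) :
    set (option T * option T') :=
  [set p | (exists2 q, S q & p = (Some q.1, Some q.2)) \/
           (exists2 i, i < d & p = (const T i, const T' i))].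

Definition atoms_agree (d : nat) (T T' : plane_ctree) (S : set (T * T')) :=
  forall p q, vals d S p -> vals d S q ->
  [/\ holds2 eq p.1 q.1 <-> holds2 eq p.2 q.2,
      holds2 (@parnt T) p.1 q.1 <-> holds2 (@parnt T') p.2 q.2 &
      holds2 (@succ T) p.1 q.1 <-> holds2 (@succ T') p.2 q.2].

(** Positions are sets of pairs; as equality is among the atoms, such a set is a partial injection.
    Moves start from pairs of [S], never from constants, just as local quantifiers range over
    neighbors of variables. *)
Fixpoint locequiv (d k : nat) (T T' : plane_ctree) (S : set (T * T')) : Prop :=
  atoms_agree d S /\
  if k is k'.+1 then forall a b, S (a, b) ->
    (forall x, adj a x ->
       exists2 y, adj b y & locequiv d k' (S `|` [set (x, y)])) /\
    (forall y, adj b y ->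
       exists2 x, adj a x & locequiv d k' (S `|` [set (x, y)]))
  else True.

Section LocalEquivalence.
Variable d : nat.

Section TwoTrees.
Variables T T' : plane_ctree.
Implicit Types S : set (T * T').

Lemma locequiv_atoms k S : locequiv d k S -> atoms_agree d S.
Proof. by case: k => [|k] []. Qed.

Lemma locequiv_vals k S a b a' b' : locequiv d k S -> S (a, b) -> S (a', b') ->
  [/\ a = a' <-> b = b', parnt a a' <-> parnt b b' & succ a a' <-> succ b b'].
Proof.
move=> /locequiv_atoms At ab ab'.
by apply: (At (Some a, Some b) (Some a', Some b')); left;
  [exists (a, b)|exists (a', b')].
Qed.

Lemma vals_sub S S' : S' `<=` S -> vals d S' `<=` vals d S.
Proof.
by move=> SS' p [[q /SS' qS ->]|[i id ->]]; [left; exists q|right; exists i].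
Qed.

Lemma locequiv_sub k S S' : S' `<=` S -> locequiv d k S -> locequiv d k S'.
Proof.
elim: k S S' => [|k IH] S S' SS' [At E];
  (split; first by move=> p q /(vals_sub SS') pS /(vals_sub SS'); apply: At) => //.
move=> a b /SS' /E [forth back]; split=> [x /forth|y /back] [z bz ez];
  by exists z => //; apply: IH ez; apply: setSU.
Qed.

Lemma locequiv_pred k S : locequiv d k.+1 S -> locequiv d k S.
Proof.
elim: k S => [|k IH] S [At E]; first by [].
split=> // a b /E [forth back]; split=> [x /forth|y /back] [z bz ez];
  by exists z => //; apply: IH.
Qed.

Lemma locequiv_le k l S : k <= l -> locequiv d l S -> locequiv d k S.
Proof.
move=> kl; rewrite -(subnK kl); elim: (l - k) => [//|m IH].
by rewrite addSn => /locequiv_pred.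
Qed.

End TwoTrees.

Lemma locequiv_sym (T T' : plane_ctree) k (S : set (T * T')) :
  locequiv d k S -> locequiv d k [set p : T' * T | S (p.2, p.1)].
Proof.
have sub (S0 : set (T * T')) (x : T) (y : T') :
    [set p | S0 (p.2, p.1)] `|` [set (y, x)] `<=`
    [set p : T' * T | (S0 `|` [set (x, y)]) (p.2, p.1)].
  by move=> [u v] /= [?|[-> ->]]; [left|right].
have valsC (S0 : set (T * T')) p : vals d [set p | S0 (p.2, p.1)] p ->
    vals d S0 (p.2, p.1).
  case=> [[[a b] /= ab ->]|[i id ->]]; first by left; exists (b, a).
  by right; exists i.
elim: k S => [|k IH] S [At E]; (split; first by
  move=> p q /valsC pS /valsC qS; have [??? /=] := At _ _ pS qS; split;
  apply: iff_sym) => //.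
move=> a b /= /E [forth back]; split=> [x /back|y /forth] [z bz /IH ez];
  by exists z => //; apply: locequiv_sub ez; apply: sub.
Qed.

(** Walking from a to x costs one round per step; the intermediate nodes are then forgotten. *)
Lemma locequiv_near (T T' : plane_ctree) r k (S : set (T * T')) a b x :
  locequiv d (r + k) S -> S (a, b) -> within_dist r a x ->
  exists2 y, within_dist r b y & locequiv d k (S `|` [set (x, y)]).
Proof.
elim: r S a b => [|r IH] S a b /=.
  move=> E ab <-; exists b => //; apply: locequiv_sub E.
  by move=> p [//|->].
move=> E ab [z [[<-|az] zx]].
  have [y by_ Ey] := IH _ _ _ (locequiv_pred E) ab zx.
  by exists y => //; exists b; split; [left|].
have [_ /(_ _ _ ab)[/(_ _ az)[w bw Ew] _]] := E.
have [|y wy Ey] := IH _ z w Ew _ zx; first by right.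
exists y; first by exists w; split; [right|].
by apply: locequiv_sub Ey; apply: setSU => p; left.
Qed.

(** * Gluing far positions, descending, and pulling back families *)

Section Moves.
Variables T T' : plane_ctree.
Implicit Types S : set (T * T').

Definition far k S1 S2 := forall a b a' b', S1 (a, b) -> S2 (a', b') ->
  ~ within_dist k a a' /\ ~ within_dist k b b'.

Lemma far_sym k S1 S2 : far k S1 S2 -> far k S2 S1.
Proof.
move=> farS a b a' b' ab ab'; have [na nb] := farS _ _ _ _ ab' ab.
by split=> /near_sym.
Qed.

Lemma far_adj k S1 S2 a b x y : far k.+1 S1 S2 -> S1 (a, b) ->
  adj a x -> adj b y -> far k (S1 `|` [set (x, y)]) S2.
Proof.
move=> farS ab ax by_ a1 b1 a2 b2 [ab1|[-> ->]] ab2.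
  by have [na nb] := farS _ _ _ _ ab1 ab2; split=> /(near_le (leqnSn k)).
have [na nb] := farS _ _ _ _ ab ab2.
by split=> n2; [apply: na|apply: nb]; [exists x|exists y]; split=> //; right.
Qed.

Lemma atoms_agree_union k S1 S2 : far k.+1 S1 S2 ->
  atoms_agree d S1 -> atoms_agree d S2 -> atoms_agree d (S1 `|` S2).
Proof.
move=> farS At1 At2 p q.
have not_adj (T0 : plane_ctree) (x y : T0) :
    ~ within_dist k.+1 x y -> [/\ ~ x = y, ~ adj x y & ~ adj y x].
  move=> nxy; split=> [E|/near_adj n1|/adj_sym/near_adj n1]; apply: nxy.
  - by rewrite E; apply: near_refl.
  - exact: near_le n1.
  - exact: near_le n1.
have valsU p0 : vals d (S1 `|` S2) p0 -> [\/ vals d S1 p0 /\ vals d S2 p0,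
    exists2 v, S1 v & p0 = (Some v.1, Some v.2) |
    exists2 v, S2 v & p0 = (Some v.1, Some v.2)].
  case=> [[v [vS|vS] ->]|[i id ->]]; [constructor 2|constructor 3|constructor 1].
  - by exists v.
  - by exists v.
  - by split; right; exists i.
have val1 v : S1 v -> vals d S1 (Some v.1, Some v.2) by move=> ?; left; exists v.
have val2 v : S2 v -> vals d S2 (Some v.1, Some v.2) by move=> ?; left; exists v.
move=> /valsU [[p1 p2]|[[a b] ab ->]|[[a b] ab ->]]
       /valsU [[q1 q2]|[[a' b'] ab' ->]|[[a' b'] ab' ->]].
- exact: At1.
- by apply: At1 => //; apply: val1.
- by apply: At2 => //; apply: val2.
- by apply: At1 => //; apply: val1.
- by apply: At1; apply: val1.
- have [/not_adj[/= ? n1 n2] /not_adj[/= ? n3 n4]] := farS _ _ _ _ ab ab'.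
  by rewrite /adj in n1 n2 n3 n4; split; tauto.
- by apply: At2 => //; apply: val2.
- have [/not_adj[/= ? n1 n2] /not_adj[/= ? n3 n4]] := farS _ _ _ _ ab' ab.
  rewrite /adj in n1 n2 n3 n4; split; try tauto.
  by split=> E; exfalso; auto.
- by apply: At2; apply: val2.
Qed.

(** Each move brings the two sides closer by at most one, so they are never adjacent or equal during
    k rounds and no atom links them. Atoms with constants are checked within each side. *)
Lemma locequiv_union k S1 S2 : far k.+1 S1 S2 ->
  locequiv d k S1 -> locequiv d k S2 -> locequiv d k (S1 `|` S2).
Proof.
elim: k S1 S2 => [|k IH] S1 S2 farS [At1 E1] [At2 E2];
  (split; first exact: atoms_agree_union farS At1 At2) => //.
have L1 : locequiv d k S1 by apply: locequiv_pred; split.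
have L2 : locequiv d k S2 by apply: locequiv_pred; split.
move=> a b [ab|ab]; [have [forth back] := E1 _ _ ab|have [forth back] := E2 _ _ ab].
- split=> [x ax|y by_]; [have [y by_ L] := forth x ax; exists y => //|
                         have [x ax L] := back y by_; exists x => //];
  by rewrite setUAC; apply: IH L L2; apply: far_adj ab ax by_.
- split=> [x ax|y by_]; [have [y by_ L] := forth x ax; exists y => //|
                         have [x ax L] := back y by_; exists x => //];
  rewrite -setUA; apply: IH L1 L; apply: far_sym;
  by apply: far_adj ab ax by_; apply: far_sym.
Qed.

Lemma locequiv_child k u u' x : locequiv d k.+1 [set (u, u') : T * T'] ->
  anc x = u -> exists2 x', anc x' = u' & locequiv d k [set (x, x')].
Proof.
move=> E; rewrite {1}/anc; case px: (parent x) => [z|] /= eu; subst.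
  have [_ /(_ _ _ erefl)[forth _]] := E.
  have [|x' ux Ex] := forth x; first by left; left.
  have [||_ [/(_ px) px' _] _] :=
      locequiv_vals Ex (a := x) (b := x') (a' := u) (b' := u').
  - by right.
  - by left.
  exists x'; first by rewrite /anc px'.
  by apply: locequiv_sub Ex => p; right.
(* Here x is the root and equals u; a parent of u' would be answered by a parent of u. *)
exists u'; last exact: locequiv_pred.
rewrite /anc; case pu: (parent u') => [z'|] //=; exfalso.
have [_ /(_ _ _ erefl)[_ back]] := E.
have [|z uz Ez] := back z'; first by left; right.
have [||_ [_ /(_ pu) pz] _] :=
    locequiv_vals Ez (a := u) (b := u') (a' := z) (b' := z').
- by left.
- by right.
by rewrite /parnt px in pz.
Qed.

Lemma locequiv_descendant h k u u' x :
  locequiv d (h + k) [set (u, u') : T * T'] -> iter h (@anc T) x = u ->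
  exists2 x', iter h (@anc T') x' = u' & locequiv d k [set (x, x')].
Proof.
elim: h u u' => [|h IH] u u' /=; first by move=> E ->; exists u'.
move=> E /(locequiv_child E) [y' yu' /IH /(_ erefl) [x' xy' Ex]].
by exists x' => //; rewrite xy'.
Qed.

(** The nodes are pulled back one at a time, each for r rounds. *)
Lemma locequiv_near_family r k m S (g : nat -> T') :
  (forall j, j < m -> exists a b, S (a, b) /\ within_dist r b (g j)) ->
  locequiv d (m * r + k) S ->
  exists f : nat -> T,
    (forall j, j < m -> exists a b, S (a, b) /\ within_dist r a (f j)) /\
    locequiv d k (S `|` [set p | exists2 j, j < m & p = (f j, g j)]).
Proof.
elim: m k => [|m IH] k gnear E.
  exists (fun=> troot T); split=> //; apply: locequiv_sub E.
  by move=> p [//|[]].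
have [||f [fnear Ef]] := IH (r + k).
- by move=> j jm; apply: gnear; apply: ltnW.
- by rewrite addnCA addnA -mulSn.
have [a [b [ab bg]]] := gnear m (ltnSn m).
have [|x ax Ex] := @locequiv_near T' T r k _ b a (g m) (locequiv_sym Ef) _ bg.
  by left.
exists (fun j => if j == m then x else f j); split=> [j|].
  rewrite ltnS; case: eqP => [_ _|/eqP jm jm']; first by exists a, b.
  by apply: fnear; rewrite ltn_neqAle jm.
apply: locequiv_sub (locequiv_sym Ex) => -[u v] [uv|[j jm [-> ->]]].
  by left; left.
case: eqP => [->|/eqP jm']; first by right.
by left; right; exists j => //; rewrite ltn_neqAle jm' -ltnS.
Qed.

End Moves.
End LocalEquivalence.

(** * Local equivalence and local formulas *)

Definition graph (T T' : plane_ctree) n (e : 'I_n -> T) (e' : 'I_n -> T') :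
    set (T * T') :=
  [set p | exists i, p = (e i, e' i)].

Lemma env_cons0 (V : Type) n (v : V) (e : 'I_n -> V) : env_cons v e ord0 = v.
Proof. by rewrite /env_cons unlift_none. Qed.

Lemma env_consS (V : Type) n (v : V) (e : 'I_n -> V) i :
  env_cons v e (lift ord0 i) = e i.
Proof. by rewrite /env_cons liftK. Qed.

Lemma graph_cons (T T' : plane_ctree) n (e : 'I_n -> T) (e' : 'I_n -> T') x y :
  graph (env_cons x e) (env_cons y e') = graph e e' `|` [set (x, y)].
Proof.
apply/seteqP; split=> p /=.
  case=> i ->; case: (unliftP ord0 i) => [j|] ->.
    by left; exists j; rewrite !env_consS.
  by right; rewrite !env_cons0.
case=> [[i ->]|->].
  by exists (lift ord0 i); rewrite !env_consS.
by exists ord0; rewrite !env_cons0.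
Qed.

Lemma sat_nbr (T : plane_ctree) n (e : 'I_n -> T) z v :
  sat (nbr z) (env_cons v e) <-> adj (e z) v.
Proof. by rewrite /= env_cons0 env_consS. Qed.

Lemma vals_term d (T T' : plane_ctree) n (e : 'I_n -> T) (e' : 'I_n -> T') t :
  term_below d t -> vals d (graph e e') (eval e t, eval e' t).
Proof.
case: t => [i _|i id]; last by right; exists i.
by left; exists (e i, e' i) => //; exists i.
Qed.

Lemma locequiv_terms d k (T T' : plane_ctree) n (e : 'I_n -> T)
    (e' : 'I_n -> T') t u :
  term_below d t && term_below d u -> locequiv d k (graph e e') ->
  [/\ holds2 eq (eval e t) (eval e u) <-> holds2 eq (eval e' t) (eval e' u),
      holds2 (@parnt T) (eval e t) (eval e u) <->
        holds2 (@parnt T') (eval e' t) (eval e' u) &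
      holds2 (@succ T) (eval e t) (eval e u) <->
        holds2 (@succ T') (eval e' t) (eval e' u)].
Proof.
move=> /andP[td ud] /locequiv_atoms At.
exact: At (vals_term e e' td) (vals_term e e' ud).
Qed.

Lemma locequiv_graph_sym d k (T T' : plane_ctree) n (e : 'I_n -> T)
    (e' : 'I_n -> T') : locequiv d k (graph e e') -> locequiv d k (graph e' e).
Proof.
by move=> /locequiv_sym; apply: locequiv_sub => p [i ->]; exists i.
Qed.

(** The guard [nbr] is quantifier free, so each local quantifier costs exactly one round. *)
Lemma locequiv_sat d n (phi : formula n) : local phi ->
  forall k (T T' : plane_ctree) (e : 'I_n -> T) (e' : 'I_n -> T'),
  qdepth phi <= k -> csts_below d phi -> locequiv d k (graph e e') ->
  sat phi e <-> sat phi e'.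
Proof.
elim=> {n phi} [n|n t u|n t u|n t u|n f g _ IHf _ IHg|n f g _ IHf _ IHg
  |n f g _ IHf _ IHg|n z f _ IH|n z f _ IH] k T T' e e' /=.
- by [].
- by move=> _ c /(locequiv_terms c)[].
- by move=> _ c /(locequiv_terms c)[].
- by move=> _ c /(locequiv_terms c)[].
- rewrite geq_max => /andP[qf qg] /andP[cf cg] E.
  by have := IHf k _ _ _ _ qf cf E; have := IHg k _ _ _ _ qg cg E; tauto.
- rewrite geq_max => /andP[qf qg] /andP[cf cg] E.
  by have := IHf k _ _ _ _ qf cf E; have := IHg k _ _ _ _ qg cg E; tauto.
- rewrite geq_max => /andP[qf qg] /andP[cf cg] E.
  by have := IHf k _ _ _ _ qf cf E; have := IHg k _ _ _ _ qg cg E; tauto.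
- rewrite !max0n; case: k => // k qf cf [_ E].
  have ez : graph e e' (e z, e' z) by exists z.
  have [forth back] := E _ _ ez.
  split=> H v /sat_nbr nv.
    have [x ax] := back v nv; rewrite -graph_cons => Ex.
    by apply/(IH k _ _ _ _ qf cf Ex)/H/sat_nbr.
  have [y ay] := forth v nv; rewrite -graph_cons => Ey.
  by apply/(IH k _ _ _ _ qf cf Ey)/H/sat_nbr.
- rewrite !max0n; case: k => // k qf cf [_ E].
  have ez : graph e e' (e z, e' z) by exists z.
  have [forth back] := E _ _ ez.
  split=> -[v [/sat_nbr nv H]].
    have [y ay] := forth v nv; rewrite -graph_cons => Ey.
    by exists y; split; [apply/sat_nbr|apply/(IH k _ _ _ _ qf cf Ey)].
  have [x ax] := back v nv; rewrite -graph_cons => Ex.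
  by exists x; split; [apply/sat_nbr|apply/(IH k _ _ _ _ qf cf Ex)].
Qed.

Definition bterm d n (t : 'I_n + 'I_d) : term n :=
  match t with inl i => Var i | inr i => Cst i end.

(** A finite index for the atomic formulas with constants below d; the [option bool] selects the
    relation. *)
Definition batom d n (x : option bool * ('I_n + 'I_d) * ('I_n + 'I_d)) :
    formula n :=
  let: (r, t, u) := x in
  match r with
  | None => Equ (bterm t) (bterm u)
  | Some true => Par (bterm t) (bterm u)
  | Some false => Suc (bterm t) (bterm u)
  end.

Lemma batom_local d n (x : option bool * ('I_n + 'I_d) * ('I_n + 'I_d)) :
  [/\ local (batom x), qdepth (batom x) = 0 & csts_below d (batom x)].
Proof.
have tb (t : 'I_n + 'I_d) : term_below d (bterm t) by case: t => i /=.
by case: x => [[[[]|] t] u] /=; rewrite !tb; split=> //; constructor.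
Qed.

Lemma batom_agree d (T T' : plane_ctree) n (e : 'I_n -> T) (e' : 'I_n -> T') :
  (forall x, sat (@batom d n x) e <-> sat (batom x) e') ->
  atoms_agree d (graph e e').
Proof.
move=> H; have valsP p : vals d (graph e e') p ->
    exists t : 'I_n + 'I_d, p = (eval e (bterm t), eval e' (bterm t)).
  case=> [[q [i ->] ->]|[i id ->]]; first by exists (inl i).
  by exists (inr (Ordinal id)).
move=> p q /valsP[t ->] /valsP[u ->]; split.
- exact: (H (None, t, u)).
- exact: (H (Some true, t, u)).
- exact: (H (Some false, t, u)).
Qed.

Definition lit n (b : bool) (f : formula n) : formula n :=
  if b then f else Imp f Bot.

Definition conj_lits n (X : finType) (F : X -> formula n) (m : {ffun X -> bool}) :
    formula n :=
  foldr (fun x => And (lit (m x) (F x))) (Imp Bot Bot) (enum X).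

Lemma sat_conj_lits (T : plane_ctree) n (X : finType) (F : X -> formula n)
    (m : {ffun X -> bool}) (e : 'I_n -> T) :
  sat (conj_lits F m) e <-> forall x, m x <-> sat (F x) e.
Proof.
have -> : (forall x, m x <-> sat (F x) e) <->
          (forall x, x \in enum X -> m x <-> sat (F x) e).
  by split=> H x *; apply: H => //; rewrite mem_enum.
rewrite /conj_lits; elim: (enum X) => [|x s IH] /=; first by split.
rewrite IH; have -> : sat (lit (m x) (F x)) e <-> (m x <-> sat (F x) e).
  by case: (m x) => /=; split=> [|[]]; auto.
split=> [[Hx Hs] y|H].
  by rewrite inE => /predU1P[->//|/Hs].
split=> [|y ys]; apply: H; rewrite inE ?eqxx //.
by rewrite ys orbT.
Qed.

Lemma conj_lits_local d k n (X : finType) (F : X -> formula n) m :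
  (forall x, [/\ local (F x), qdepth (F x) <= k & csts_below d (F x)]) ->
  [/\ local (conj_lits F m), qdepth (conj_lits F m) <= k &
      csts_below d (conj_lits F m)].
Proof.
move=> HF; rewrite /conj_lits; elim: (enum X) => [|x s [IH1 IH2 IH3]] /=.
  by split=> //; do !constructor.
have [F1 F2 F3] := HF x; rewrite IH3 geq_max IH2.
by case: (m x) => /=; rewrite ?maxn0 ?F2 ?F3; split=> //; do !constructor.
Qed.

(* The converse of [locequiv_sat]: finitely many local formulas of depth [k]  *)
(* suffice to force local equivalence. At depth [k.+1] one asks, for each     *)
(* variable z, which truth patterns of the depth-k formulas are realized by   *)
(* some neighbor of z.                                                        *)
Lemma locequiv_formulas d k n : exists (X : finType) (F : X -> formula n),
  (forall x, [/\ local (F x), qdepth (F x) <= k & csts_below d (F x)]) /\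
  forall (T T' : plane_ctree) (e : 'I_n -> T) (e' : 'I_n -> T'),
    (forall x, sat (F x) e <-> sat (F x) e') -> locequiv d k (graph e e').
Proof.
elim: k n => [|k IH] n.
  exists (option bool * ('I_n + 'I_d) * ('I_n + 'I_d))%type, (@batom d n).
  split=> [x|T T' e e' H]; first by have [? -> ?] := batom_local x.
  by split=> //; apply: batom_agree.
have [X [F [HF Hequiv]]] := IH n.+1.
pose A : finType := (option bool * ('I_n + 'I_d) * ('I_n + 'I_d))%type.
pose B : finType := ('I_n * {ffun X -> bool})%type.
pose G (x : A + B) := match x with
  | inl a => batom a
  | inr (z, m) => ExiNbr z (conj_lits F m)
  end.
exists (A + B)%type, G; split.
  case=> [a|[z m]]; first by have [? E ?] := batom_local a; rewrite /G E.
  have [c1 c2 c3] := conj_lits_local m HF.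
  by split; [apply: local_ExiNbr|rewrite /= !max0n|].
have half (T T' : plane_ctree) (e : 'I_n -> T) (e' : 'I_n -> T') :
    (forall x, sat (G x) e <-> sat (G x) e') -> forall z x, adj (e z) x ->
    exists2 y, adj (e' z) y & locequiv d k (graph e e' `|` [set (x, y)]).
  move=> H z x zx.
  pose m := [ffun i => `[< sat (F i) (env_cons x e) >]].
  have mP i : m i <-> sat (F i) (env_cons x e).
    by rewrite ffunE; split => /asboolP.
  have /(H (inr (z, m))) : sat (G (inr (z, m))) e.
    by exists x; split; [apply/sat_nbr|apply/sat_conj_lits].
  move=> [y [/sat_nbr zy /sat_conj_lits my]].
  exists y => //; rewrite -graph_cons; apply: Hequiv => i.
  by rewrite -mP my.
move=> T T' e e' H; split; first by apply: (@batom_agree d) => a; apply: (H (inl a)).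
move=> _ _ [z [-> ->]]; split=> [x|y zy]; first exact: half.
have [x zx Ex] := half T' T e' e (fun x => iff_sym (H x)) z y zy.
by exists x => //; move: Ex; rewrite -!graph_cons => /locequiv_graph_sym.
Qed.

(** The Hintikka type with separate bounds for constants and depth: the depth varies during the game
    while the constants stay fixed. *)
Definition ltype (d k : nat) (T : plane_ctree) (v : T) : set (formula 1) :=
  [set phi | [/\ local phi, qdepth phi <= k, csts_below d phi &
                 sat phi (fun=> v)]].

Lemma graph1 (T T' : plane_ctree) (v : T) (v' : T') :
  graph (fun _ : 'I_1 => v) (fun=> v') = [set (v, v')].
Proof. by apply/seteqP; split=> p => [[i ->]|->] //; exists ord0. Qed.

Lemma ltype_locequiv d k (T T' : plane_ctree) (v : T) (v' : T') :
  ltype d k v = ltype d k v' <-> locequiv d k [set (v, v')].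
Proof.
rewrite -graph1; split=> [E|E].
  have [X [F [HF]]] := locequiv_formulas d k 1; apply=> x.
  have [F1 F2 F3] := HF x.
  have: ltype d k v (F x) = ltype d k v' (F x) by rewrite E.
  rewrite /ltype /= => Ex; split=> Fx.
    by have: [/\ local (F x), qdepth (F x) <= k, csts_below d (F x) &
                 sat (F x) (fun=> v)] by []; rewrite Ex => -[].
  by have: [/\ local (F x), qdepth (F x) <= k, csts_below d (F x) &
               sat (F x) (fun=> v')] by []; rewrite -Ex => -[].
apply/seteqP; split=> phi [l q c] H; split=> //.
  exact/(locequiv_sat l q c E).
exact/(locequiv_sat l q c E).
Qed.

Lemma hintikka_ltype d D k (T T' : plane_ctree) (v : T) (v' : T') :
  d <= D -> k <= D -> hintikka_type D v = hintikka_type D v' ->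
  ltype d k v = ltype d k v'.
Proof.
move=> dD kD E.
have below n (phi : formula n) : csts_below d phi -> csts_below D phi.
  have tb n0 (t : term n0) : term_below d t -> term_below D t.
    by case: t => //= i id; apply: leq_trans id dD.
  by elim: phi => //= {}n => [t u|t u|t u|f IHf g IHg|f IHf g IHg|f IHf g IHg]
    /andP[]; rewrite ?andbT => *; apply/andP; auto.
have incl (T1 T2 : plane_ctree) (v1 : T1) (v2 : T2) :
    hintikka_type D v1 = hintikka_type D v2 -> ltype d k v1 `<=` ltype d k v2.
  move=> E12 phi [l q c s]; split=> //.
  have: hintikka_type D v1 phi.
    by split=> //; rewrite /d_formula (leq_trans q kD) below.
  by rewrite E12 => -[].
by apply/seteqP; split; apply: incl.
Qed.

(** * Counting nodes *)

Definition at_least (m : nat) (V : Type) (P : set V) : Prop :=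
  exists g : nat -> V, (forall j, j < m -> P (g j)) /\
    forall i j, i < m -> j < m -> g i = g j -> i = j.

Lemma card_le_inj (T U : Type) (u0 : U) (A : set T) (B : set U) : A #<= B ->
  exists f : T -> U, (forall x, A x -> B (f x)) /\
    forall x y, A x -> A y -> f x = f y -> x = y.
Proof.
move=> /card_leP[f].
pose F x := if pselect (A x) is left Ax then val (f (SigSub (mem_set Ax))) else u0.
exists F; rewrite /F; split=> [x Ax|x y Ax Ay].
  by case: pselect => // Ax'; apply: set_valP.
case: pselect => // Ax'; case: pselect => // Ay' /val_inj.
by move=> /(@inj _ _ _ f); rewrite !inE => /(_ I I) [].
Qed.

Lemma card_le_at_least m (V : Type) (v0 : V) (P : set V) :
  `I_m #<= P -> at_least m P.
Proof. by move=> /(card_le_inj v0) [g [gP ginj]]; exists g. Qed.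

Lemma at_least_le m n (V : Type) (P : set V) :
  m <= n -> at_least n P -> at_least m P.
Proof.
move=> mn [g [gP ginj]]; exists g; split=> [j jm|i j im jm].
  by apply: gP; apply: leq_trans mn.
by apply: ginj; [apply: leq_trans im mn|apply: leq_trans jm mn].
Qed.

Lemma at_least_sub m (V : Type) (P Q : set V) :
  P `<=` Q -> at_least m P -> at_least m Q.
Proof. by move=> PQ [g [gP ginj]]; exists g; split=> // j /gP/PQ. Qed.

Lemma at_least_or_enum N (V : Type) (v0 : V) (P : set V) : at_least N.+1 P \/
  exists m (g : nat -> V), [/\ m <= N, forall j, j < m -> P (g j),
    forall i j, i < m -> j < m -> g i = g j -> i = j &
    forall x, P x -> exists2 j, j < m & g j = x].
Proof.
elim: N => [|N [[g [gP ginj]]|[m [g [mN gP ginj gsurj]]]]].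
- have [[x Px]|nP] := pselect (exists x, P x).
    by left; exists (fun=> x); split=> // -[|i] [|j].
  right; exists 0, (fun=> v0); split=> // x Px; exfalso; apply: nP; by exists x.
- have [[x [Px xg]]|nP] :=
      pselect (exists x, P x /\ forall j, j < N.+1 -> g j <> x).
    left; exists (fun j => if j == N.+1 then x else g j); split=> [j|i j].
      rewrite ltnS leq_eqVlt; case: eqP => //= _; exact: gP.
    rewrite !ltnS (leq_eqVlt i) (leq_eqVlt j).
    case: (eqVneq i N.+1) => [->|_] /=; case: (eqVneq j N.+1) => [->|_] //=.
    + by move=> _ /xg ne E; case: ne.
    + by move=> /xg.
    + exact: ginj.
  right; exists N.+1, g; split=> // x Px; apply: contrapT => nx; apply: nP.
  by exists x; split=> // j jN gx; apply: nx; exists j.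
- by right; exists m, g; split=> //; apply: leqW.
Qed.

Lemma at_least_avoid N (V : Type) (P : set V) (X : finType) (f : X -> V) :
  at_least N.+1 P -> #|X| <= N -> exists2 x, P x & forall i, f i <> x.
Proof.
move=> [g [gP ginj]] XN; apply: contrapT => nP.
have /choice[c cP] : forall j : 'I_N.+1, exists i, f i = g j.
  move=> j; apply: contrapT => nj; apply: nP.
  by exists (g j); [apply: gP|move=> i fi; apply: nj; exists i].
have cinj : injective c.
  by move=> i j cij; apply/ord_inj/ginj => //; rewrite -!cP cij.
by have := leq_card c cinj; rewrite card_ord leqNgt ltnS XN.
Qed.

Definition counts_agree (D Gamma : nat) (T T' : plane_ctree) : Prop :=
  forall tau : set (formula 1),
    (nodes_of_type D T tau #= nodes_of_type D T' tau) \/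
    ((`I_Gamma #<= nodes_of_type D T tau) /\
     (`I_Gamma #<= nodes_of_type D T' tau)).

Lemma counts_agree_sym D Gamma (T T' : plane_ctree) :
  counts_agree D Gamma T T' -> counts_agree D Gamma T' T.
Proof.
by move=> H tau; case: (H tau) => [E|[? ?]]; [left; rewrite card_eq_sym|right].
Qed.

(** Every type met in [P] has all its [T']-nodes in [P'], hence fewer than Gamma of them, so its
    counts are equal. The injections chosen type by type preserve types and therefore glue to an
    injection. *)
Lemma counts_agree_inj D Gamma (T T' : plane_ctree) (P : set T) (P' : set T') :
  counts_agree D Gamma T T' ->
  (forall v v', hintikka_type D v = hintikka_type D v' -> P v -> P' v') ->
  ~ at_least Gamma P' ->
  exists f : T -> T', (forall x, P x -> P' (f x)) /\
    forall x y, P x -> P y -> f x = f y -> x = y.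
Proof.
move=> H PP' few.
have /choice[F HF] : forall tau, exists f : T -> T',
    (exists2 x, P x & hintikka_type D x = tau) ->
    (forall x, hintikka_type D x = tau -> hintikka_type D (f x) = tau) /\
    (forall x y, hintikka_type D x = tau -> hintikka_type D y = tau ->
      f x = f y -> x = y).
  move=> tau; case: (H tau) => [|[_ /(card_le_at_least (troot T')) many]].
    rewrite card_eq_le => /andP[/(card_le_inj (troot T')) [f [f1 f2]] _].
    by exists f.
  exists (fun=> troot T') => -[x Px xtau]; exfalso; apply: few.
  by apply: at_least_sub many => v' /= v'tau; apply: PP' Px; rewrite v'tau.
have HF' x : P x -> hintikka_type D (F (hintikka_type D x) x) = hintikka_type D x.
  by move=> Px; have [|-> //] := HF (hintikka_type D x); exists x.
exists (fun x => F (hintikka_type D x) x); split=> [x Px|x y Px Py E].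
  by apply: PP' (Px); rewrite HF'.
have xy : hintikka_type D x = hintikka_type D y by rewrite -HF' // E HF'.
by have [|_] := HF (hintikka_type D x); [exists x|apply=> //; rewrite {2}xy].
Qed.

(** * Answers to a single move *)

(* The far move. [a] is far from the pebbles; [u] is its h-th ancestor. If    *)
(* [T'] has many nodes of the local type of [u], one of them is not among the *)
(* few ancestors of the pebbles, and the copy of [a] below it is far. If it   *)
(* has few, either one of them is far from the pebbles, or all of them can be *)
(* pulled back to nodes near the pebbles of [T]; as [T] has no others, [u] is *)
(* one of these, and [a] is not far.                                          *)
Lemma far_response d D Gamma k n (T T' : plane_ctree) (e : 'I_n -> T)
    (e' : 'I_n -> T') (h := k.+1) (N := n * (h + h).+1) a :
  counts_agree D Gamma T T' -> d <= D -> h + k <= D -> N < Gamma ->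
  locequiv d (N * (h + h) + (h + k)) (graph e e') ->
  (forall i, ~ within_dist (h + h + h) (e i) a) ->
  exists2 b, locequiv d k [set (a, b)] & forall i, ~ within_dist h (e' i) b.
Proof.
move=> H dD kD NG E afar.
pose u := iter h (@anc T) a.
have copy u' : ltype d (h + k) u' = ltype d (h + k) u ->
    exists2 b, iter h (@anc T') b = u' & locequiv d k [set (a, b)].
  by move=> /esym/ltype_locequiv/locequiv_descendant; apply.
pose P := [set v : T | ltype d (h + k) v = ltype d (h + k) u].
pose P' := [set v : T' | ltype d (h + k) v = ltype d (h + k) u].
have [many|[m [g [mN gP ginj gsurj]]]] := at_least_or_enum N (troot T') P'.
  pose c (q : 'I_n * 'I_(h + h).+1) := iter q.2 (@anc T') (e' q.1).
  have [|u' /copy[b bu' ab] cu'] := at_least_avoid c many.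
    by rewrite card_prod !card_ord.
  exists b => // i /near_sym/near_anc_iter [j Ej].
  by apply: (cu' (i, j)); rewrite -bu' Ej.
have [[u' [/copy[b bu' ab] u'far]]|allnear] :=
    pselect (exists u', P' u' /\ forall i, ~ within_dist (h + h) (e' i) u').
  exists b => // i ib; apply: (u'far i); apply: near_trans ib _.
  by apply: near_sym; rewrite -bu'; apply: near_anc.
exfalso.
have gnear j : j < m -> exists x y, graph e e' (x, y) /\ within_dist (h + h) y (g j).
  move=> jm; apply: contrapT => nj; apply: allnear.
  exists (g j); split; first exact: gP.
  by move=> i ij; apply: nj; exists (e i), (e' i); split=> //; exists i.
have [|f [fnear Ef]] := @locequiv_near_family d T T' (h + h) (h + k) m _ g gnear _.
  (* At most N nodes are pulled back for 2h rounds each; h + k rounds remain to compare types. *)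
  by apply: locequiv_le E; rewrite leq_add2r leq_mul2r mN orbT.
have fP j : j < m -> P (f j).
  move=> jm; rewrite /P /= -(gP j jm); apply/ltype_locequiv.
  by apply: locequiv_sub Ef => p ->; right; exists j.
have finj i j : i < m -> j < m -> f i = f j -> i = j.
  move=> im jm fij; apply: ginj => //.
  have [||[/(_ fij)//]] :=
      locequiv_vals Ef (a := f i) (b := g i) (a' := f j) (b' := g j).
  - by right; exists i.
  - by right; exists j.
have [|few|F [FP Finj]] := counts_agree_inj (P := P) (P' := P') H.
- by move=> v v' /(hintikka_ltype dD kD); rewrite /P /P' /= => ->.
- have [|x /gsurj[j jm gj] xg] := at_least_avoid (fun i : 'I_m => g i)
      (at_least_le (leq_ltn_trans mN NG) few).
    by rewrite card_ord.
  exact: (xg (Ordinal jm)).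
(* The m distinct nodes [f j] already exhaust [P'] under [F], so [F u] is some [F (f j)] and u =
   [f j]. *)
have /choice[c cP] : forall j : 'I_m, exists i : 'I_m, g i = F (f j).
  move=> j; have [i im gi] := gsurj _ (FP _ (fP j (ltn_ord j))).
  by exists (Ordinal im).
have cinj : injective c.
  move=> i j cij; apply/ord_inj/finj => //; apply: Finj; try exact: fP.
  by rewrite -!cP cij.
have Pu : P u by [].
have [i im gi] := gsurj _ (FP _ Pu).
have /codomP[j ij] := injF_onto cinj (Ordinal im).
have fu : f j = u.
  by apply: Finj => //; [apply: fP|rewrite -cP -ij].
have [x [y [[i0 [-> _]] nu]]] := fnear j (ltn_ord j).
rewrite fu in nu; apply: (afar i0); apply: near_trans nu _; exact: near_anc.
Qed.

(** The threshold 3h splits into h from a up to its ancestor and 2h from there to a pebble; nearer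
    moves are walked to in 3h rounds. *)
Lemma response d D Gamma k n (T T' : plane_ctree) (e : 'I_n -> T)
    (e' : 'I_n -> T') (h := k.+1) (N := n * (h + h).+1) a :
  counts_agree D Gamma T T' -> d <= D -> h + k <= D -> N < Gamma ->
  locequiv d (N * (h + h) + (h + h + h + k)) (graph e e') ->
  exists b, locequiv d k (graph e e' `|` [set (a, b)]).
Proof.
move=> H dD kD NG E.
have [[i ia]|afar] := pselect (exists i, within_dist (h + h + h) (e i) a).
  have [||b _ Eb] :=
      locequiv_near (d := d) (k := k) (S := graph e e') (b := e' i) _ _ ia.
  - by apply: locequiv_le E; apply: leq_addl.
  - by exists i.
  by exists b.
have [||b ab bfar] := far_response (e := e) (e' := e') (a := a) H dD kD NG.
- by apply: locequiv_le E; rewrite leq_add2l leq_add2r -addnA leq_addr.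
- by move=> i ia; apply: afar; exists i.
exists b; apply: locequiv_union => //; last first.
  by apply: locequiv_le E; rewrite addnA leq_addl.
move=> _ _ _ _ [i [-> ->]] [-> ->]; split; last exact: bfar.
move=> ia; apply: afar; exists i; apply: near_le ia.
by rewrite leq_addl.
Qed.

(** * The d-round game *)

(** The recursion is the round count demanded by [response], with the number of pebbles bounded by
    d. *)
Fixpoint depth (d q : nat) : nat :=
  if q is q'.+1 then
    let k := depth d q' in
    let h := k.+1 in
    d * (h + h).+1 * (h + h) + (h + h + h + k)
  else 0.

Lemma depth_le d p q : p <= q -> depth d p <= depth d q.
Proof.
move=> pq; rewrite -(subnK pq); elim: (q - p) => [//|m IH].
by apply: leq_trans IH _; rewrite addSn /= addnA leq_addl.
Qed.

(** Here n counts the pebbles and q the rounds left; n + q <= d keeps at most d pebbles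
    throughout. *)
Lemma locequiv_depth_sat d D Gamma (T T' : plane_ctree) :
  counts_agree D Gamma T T' -> d <= D -> depth d d <= D ->
  d * (depth d d).*2.+1 < Gamma ->
  forall n (phi : formula n) q (e : 'I_n -> T) (e' : 'I_n -> T'),
  n + q <= d -> qdepth phi <= q -> csts_below d phi ->
  locequiv d (depth d q) (graph e e') -> sat phi e <-> sat phi e'.
Proof.
move=> H dD DD DG n phi q e e'.
have resp T1 T2 (H12 : counts_agree D Gamma T1 T2) n0 q0
    (e1 : 'I_n0 -> T1) (e2 : 'I_n0 -> T2) :
    n0 + q0.+1 <= d -> locequiv d (depth d q0.+1) (graph e1 e2) ->
    forall a, exists b,
      locequiv d (depth d q0) (graph (env_cons a e1) (env_cons b e2)).
  move=> nq E a.
  have n0d : n0 <= d by apply: leq_trans nq; apply: leq_addr.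
  have q0d : q0.+1 <= d by apply: leq_trans nq; apply: leq_addl.
  have hd := depth_le d q0d.
  (* From this one bound on 2h follow both h + k <= D and the bound below Gamma on critical
     ancestors. *)
  have hD : (depth d q0).+1 + (depth d q0).+1 <= depth d d.
    apply: leq_trans hd => /=; set h := (depth d q0).+1.
    by rewrite -!addnA addnCA leq_add2l addnCA leq_addr.
  have [|||b Eb] := response (k := depth d q0) (e := e1) (e' := e2) a H12 dD.
  - by apply: leq_trans DD; apply: leq_trans hD; rewrite leq_add2l.
  - apply: leq_ltn_trans DG; apply: leq_mul => //; rewrite ltnS.
    by apply: leq_trans hD _; rewrite -addnn leq_addr.
  - apply: locequiv_le E => /=; rewrite leq_add2r; apply: leq_mul => //.
    exact: leq_mul.
  by exists b; rewrite graph_cons.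
have resp' n0 q0 (e1 : 'I_n0 -> T) (e2 : 'I_n0 -> T') :
    n0 + q0.+1 <= d -> locequiv d (depth d q0.+1) (graph e1 e2) ->
    forall b, exists a,
      locequiv d (depth d q0) (graph (env_cons a e1) (env_cons b e2)).
  move=> nq E b.
  have /(_ b)[a Ea] :=
    resp _ _ (counts_agree_sym H) _ _ _ _ nq (locequiv_graph_sym E).
  by exists a; apply: locequiv_graph_sym.
elim: phi q e e' => {n} [n|n t u|n t u|n t u|n f IHf g IHg|n f IHf g IHg
  |n f IHf g IHg|n f IH|n f IH] q e e' nq /=.
- by [].
- by move=> _ c /(locequiv_terms c)[].
- by move=> _ c /(locequiv_terms c)[].
- by move=> _ c /(locequiv_terms c)[].
- rewrite geq_max => /andP[qf qg] /andP[cf cg] E.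
  by have := IHf _ _ _ nq qf cf E; have := IHg _ _ _ nq qg cg E; tauto.
- rewrite geq_max => /andP[qf qg] /andP[cf cg] E.
  by have := IHf _ _ _ nq qf cf E; have := IHg _ _ _ nq qg cg E; tauto.
- rewrite geq_max => /andP[qf qg] /andP[cf cg] E.
  by have := IHf _ _ _ nq qf cf E; have := IHg _ _ _ nq qg cg E; tauto.
all: case: q nq => // q nq qf cf E; have nq' : n.+1 + q <= d by rewrite addSnnS.
all: have forth := resp _ _ H _ _ _ _ nq E; have back := resp' _ _ _ _ nq E.
- split=> Hs v; [have [w Ew] := back v|have [w Ew] := forth v];
    by apply/(IH _ _ _ nq' qf cf Ew).
- split=> -[v Hv]; [have [w Ew] := forth v|have [w Ew] := back v];
    by exists w; apply/(IH _ _ _ nq' qf cf Ew).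
Qed.

Theorem theorem7 (d : nat) :
  exists D Gamma : nat, forall T T' : plane_ctree,
    (forall tau : set (formula 1),
       (nodes_of_type D T tau #= nodes_of_type D T' tau) \/
       ((`I_Gamma #<= nodes_of_type D T tau) /\
        (`I_Gamma #<= nodes_of_type D T' tau))) ->
    d_sentences d T = d_sentences d T'.
Proof.
(* The summand d makes types see all the constants; Gamma is positive, so an abundant type is
   inhabited. *)
pose D := d + depth d d; pose Gamma := (d * (depth d d).*2.+1).+1.
exists D, Gamma => T T' H.
have incl T1 T2 : counts_agree D Gamma T1 T2 ->
    d_sentences d T1 `<=` d_sentences d T2.
  move=> H12 phi [phid M]; split=> // e'.
  (* The initial position has no pebbles but must agree on atoms between constants; these belong to
     the type of any node, so one node of equal type in each tree suffices. *)
  have [v vP] : exists v : T2, hintikka_type D v = hintikka_type D (troot T1).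
    case: (H12 (hintikka_type D (troot T1))) => [|[_]].
      rewrite card_eq_le => /andP[/(card_le_inj (troot T2)) [f [fP _]] _].
      by exists (f (troot T1)); apply: fP.
    move=> /(card_le_at_least (troot T2)) [g [gP _]].
    by exists (g 0); apply: gP.
  have /andP[qphi cphi] := phid.
  pose e : 'I_0 -> T1 := fun=> troot T1.
  apply/(locequiv_depth_sat H12 _ _ _ _ qphi cphi (e := e)) => //.
  - exact: leq_addr.
  - exact: leq_addl.
  - have /ltype_locequiv : ltype d (depth d d) (troot T1) =
        ltype d (depth d d) v.
      by apply: (hintikka_ltype (D := D)); rewrite ?leq_addr ?leq_addl ?vP.
    by apply: locequiv_sub => p [[]].
apply/seteqP; split; apply: incl => //; exact: counts_agree_sym.
Qed.
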